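(* Let $n\ge d$ be positive integers, $L=\{\ell_1,\dots,\ell_n\}$, $R=\{r_1,\dots,r_d\}$, and let $\mathcal{M}=(M_\sigma)$ be a linkage $(n,d)$-matching field on $L\sqcup R$. Then the map sending each $(n-d+1)$-subset $\rho\subseteq L$ to the right degree vector of the Chow covector $\Omega_\rho$ is a bijection from $\binom{L}{n-d+1}$ onto the set of lattice points of the dilated simplex $(n-d+1)\Delta_{d-1}$, i.e. onto $\{v\in\mathbb{Z}_{\ge 0}^d : v_1+\dots+v_d=n-d+1\}$.
   Context: All graphs are bipartite graphs on the node set $L\sqcup R$ (edges join a node of $L$ to a node of $R$), identified with their edge sets. The right degree vector of a graph is $(\deg r_1,\dots,\deg r_d)$. An $(n,d)$-matching field $\mathcal{M}=(M_\sigma)$ assigns to every $d$-subset $\sigma\subseteq L$ a perfect matching $M_\sigma$ between $\sigma$ and $R$. It is linkage if for every $r_i\in R$ and every $(d+1)$-subset $\tau\subseteq L$ there exist distinct $\ell_j,\ell_{j'}\in\tau$ such that $M_{\tau\setminus\{\ell_j\}}$ and $M_{\tau\setminus\{\ell_{j'}\}}$ agree everywhere except on the edges incident with $r_i$. For an $(n-d+1)$-subset $\rho\subseteq L$, the Chow covector $\Omega_\rho$ is the graph with edge set $\{(\ell_j,r) : \ell_j\in\rho\}$, where $r$ is the node matched to $\ell_j$ in $M_{(L\setminus\rho)\cup\{\ell_j\}}$. *)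

(* Defs.v *)
From mathcomp Require Import all_boot.
Set Implicit Arguments. Unset Strict Implicit. Unset Printing Implicit Defensive.

(* Left nodes L = 'I_n (l_1..l_n), right nodes R = 'I_d (r_1..r_d).
   A bipartite graph is identified with its edge set : {set 'I_n * 'I_d}. *)

Definition right_degree n d (G : {set 'I_n * 'I_d}) : {ffun 'I_d -> nat} :=
  [ffun r => #|[set e in G | e.2 == r]|].

Definition perfect_matching n d (sigma : {set 'I_n}) (G : {set 'I_n * 'I_d}) : Prop :=
  [/\ forall e, e \in G -> e.1 \in sigma,
      forall l, l \in sigma -> #|[set e in G | e.1 == l]| = 1
    & forall r : 'I_d, #|[set e in G | e.2 == r]| = 1].

(* An (n,d)-matching field: M sigma is a perfect matching between sigma and R
   for every d-subset sigma of L (values on other subsets are irrelevant). *)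
Definition matching_field n d (M : {set 'I_n} -> {set 'I_n * 'I_d}) : Prop :=
  forall sigma : {set 'I_n}, #|sigma| = d -> perfect_matching sigma (M sigma).

Definition edges_off n d (G : {set 'I_n * 'I_d}) (r : 'I_d) :=
  [set e in G | e.2 != r].

Definition linkage n d (M : {set 'I_n} -> {set 'I_n * 'I_d}) : Prop :=
  forall (r : 'I_d) (tau : {set 'I_n}), #|tau| = d.+1 ->
    exists l, exists l', [/\ l \in tau, l' \in tau, l != l' &
      edges_off (M (tau :\ l)) r = edges_off (M (tau :\ l')) r].

Definition chow_covector n d (M : {set 'I_n} -> {set 'I_n * 'I_d})
    (rho : {set 'I_n}) : {set 'I_n * 'I_d} :=
  [set e | (e.1 \in rho) && (e \in M ((~: rho) :|: [set e.1]))].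

(* Main.v *)
(** The source and the target have the same cardinal ['C(n, d - 1)], so it is
    enough to show that every lattice point is the degree vector of some Chow
    covector; this goes by induction on [n - d], for all [d] at once.

    If [r] is in the support of [w], the field is replaced by one with a second
    copy of [r]: in the linkage tree on a (d+1)-subset, [r] labels exactly one
    edge, and both ends of this edge are matched to the two copies of [r], the
    rest of the matching being the same whichever end is removed.  The new
    field is again linkage.  If [s] is the complement of one of its Chow covectors,
    removing from [s] the node that [M_s] matches to [r] gives a Chow covector of
    the original field with the same edges, plus one edge at [r]. *)

Require Import Defs.
From mathcomp Require Import all_boot zify.
Set Implicit Arguments. Unset Strict Implicit. Unset Printing Implicit Defensive.

(** * Matching fields as functions from right nodes to left nodes *)

(* [g s r] is the node of [s] matched to [r]. *)
Definition node_field (T R : finType) (g : {set T} -> R -> T) : Prop :=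
  forall s : {set T}, #|s| = #|R| -> injective (g s) /\ forall r, g s r \in s.

Definition node_linkage (T R : finType) (g : {set T} -> R -> T) : Prop :=
  forall r (t : {set T}), #|t| = #|R|.+1 -> exists x y, [/\ x \in t, y \in t, x != y &
    forall q, q != r -> g (t :\ x) q = g (t :\ y) q].

(* The ends of the [r]-edge of the linkage tree on [t], see [ends_pair]. *)
Definition ends (T R : finType) (g : {set T} -> R -> T) (r : R) (t : {set T}) :=
  [set g (t :\ x) r | x in t].

(** * The linkage tree of a subset with [#|R|.+1] nodes *)

(* The [#|R|] edges [u r -- v r] admit dual cuts [h r], hence form a spanning tree
   of [A]; over F_2, the cuts and the constants give all functions on [A]. *)
Lemma dual_cuts_constant (T R : finType) (A : {set T}) (u v : R -> T)
    (h : R -> pred T) (f : pred T) :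
  #|A| = #|R|.+1 -> (forall r, u r \in A) -> (forall r, v r \in A) ->
  (forall r q, h r (u q) (+) h r (v q) = (r == q)) ->
  (forall q, f (u q) = f (v q)) -> {in A &, forall x y, f x = f y}.
Proof.
move=> cardA uA vA hdual fconst.
pose val (c : {ffun R -> bool} * bool) x :=
  c.2 (+) \big[addb/false]_r (c.1 r && h r x).
(* By duality, crossing the edge [q] changes [val c] by the coefficient [c.1 q] alone. *)
have jump c q : val c (u q) (+) val c (v q) = c.1 q.
  rewrite /val addbACA addbb -big_split /= (bigD1 q) //= -andb_addr hdual eqxx.
  rewrite andbT big1 ?addbF // => r /negPf rq.
  by rewrite -andb_addr hdual rq andbF.
pose S c := [set x in A | val c x].
have SE c x : x \in A -> (x \in S c) = val c x by move=> xA; rewrite inE xA.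
have injS : injective S.
  move=> c c' eqS.
  have eqv x : x \in A -> val c x = val c' x by move=> xA; rewrite -!SE // eqS.
  have eq1 : c.1 = c'.1 by apply/ffunP => q; rewrite -!jump !eqv.
  have /card_gt0P[x xA] : 0 < #|A| by rewrite cardA.
  have := eqv x xA; rewrite /val eq1 => /addIb.
  by case: c c' eq1 {eqS eqv} => ? ? [? ?] /= -> ->.
(* Both sides have [2 ^ #|A|] elements, so every predicate agrees on [A] with some [val c]. *)
have imS : S @: [set: {ffun R -> bool} * bool] = powerset A.
  apply/eqP; rewrite eqEcard card_imset // card_powerset cardsT card_prod.
  rewrite card_ffun card_bool cardA expnSr leqnn andbT.
  by apply/subsetP => _ /imsetP[c _ ->]; rewrite inE; apply/subsetP => x /setIdP[].
have : [set x in A | f x] \in powerset A.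
  by rewrite inE; apply/subsetP => x /setIdP[].
rewrite -imS => /imsetP[c _ eqf].
have fE x : x \in A -> f x = val c x by move=> xA; rewrite -SE // -eqf inE xA.
have c0 q : c.1 q = false by rewrite -jump -!fE // fconst addbb.
have fc x : x \in A -> f x = c.2.
  by move/fE->; rewrite /val big1 ?addbF // => r _; rewrite c0.
by move=> x y xA yA; rewrite !fc.
Qed.

Lemma node_field_onto (T R : finType) (g : {set T} -> R -> T) (s : {set T}) x :
  node_field g -> #|s| = #|R| -> x \in s -> exists r, g s r = x.
Proof.
move=> gF cs; have [ginj gin] := gF s cs.
have /eqP ims : g s @: [set: R] == s.
  rewrite eqEcard card_imset // cardsT cs leqnn andbT.
  by apply/subsetP => _ /imsetP[r _ ->].
by rewrite -[in X in X -> _]ims => /imsetP[r _ ->]; exists r.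
Qed.

Lemma cardsD1_pred (T : finType) (A : {set T}) x k :
  #|A| = k.+1 -> x \in A -> #|A :\ x| = k.
Proof. by rewrite (cardsD1 x A) => + xA; rewrite xA => -[]. Qed.

(** If [y] were matched in [t :\ x] to some [q != r], the agreement would match [q] to [y] in
    [t :\ y] too, where [y] is absent. *)
Lemma linkage_swap (T R : finType) (g : {set T} -> R -> T) (r : R) (t : {set T}) x y :
  node_field g -> #|t| = #|R|.+1 -> x \in t -> y \in t -> x != y ->
  (forall q, q != r -> g (t :\ x) q = g (t :\ y) q) -> g (t :\ x) r = y.
Proof.
move=> gF ct xt yt nxy agree.
have ytx : y \in t :\ x by rewrite !inE eq_sym nxy.
have [q gq] := node_field_onto gF (cardsD1_pred ct xt) ytx.
have [qr|qr] := eqVneq q r; first by rewrite -qr.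
have [_ /(_ q)] := gF _ (cardsD1_pred ct yt).
by rewrite -agree // gq !inE eqxx.
Qed.

(* Joining the two nodes of each linkage by an edge yields a tree on [t], whose
   [r]-edge consists of the only nodes ever matched to [r] inside [t]. *)
Lemma ends_pair (T R : finType) (g : {set T} -> R -> T) (r : R) (t : {set T}) :
  node_field g -> node_linkage g -> #|t| = #|R|.+1 -> exists x y,
  [/\ x \in t, y \in t, x != y, ends g r t = [set x; y] &
    [/\ g (t :\ x) r = y, g (t :\ y) r = x &
        forall q, q != r -> g (t :\ x) q = g (t :\ y) q]].
Proof.
move=> gF gL ct.
have /fin_all_exists[p pP] q : exists p : T * T, [/\ p.1 \in t, p.2 \in t,
    p.1 != p.2 & forall q', q' != q -> g (t :\ p.1) q' = g (t :\ p.2) q'].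
  by have [x [y]] := gL q t ct; exists (x, y).
have p1 q : (p q).1 \in t by case: (pP q).
have p2 q : (p q).2 \in t by case: (pP q).
have pN q : (p q).1 != (p q).2 by case: (pP q).
have pA q q' : q' != q -> g (t :\ (p q).1) q' = g (t :\ (p q).2) q'.
  by case: (pP q) => _ _ _; apply.
have g1 q : g (t :\ (p q).1) q = (p q).2.
  by apply: linkage_swap => //; apply: pA.
have g2 q : g (t :\ (p q).2) q = (p q).1.
  apply: linkage_swap => // [|q' /pA/esym//]; by rewrite eq_sym.
(* The cut dual to the [q]-edge: the node of [q] is the same whichever end of another edge is
   removed, but differs between the two ends of the [q]-edge. *)
pose h q x := g (t :\ x) q == (p q).1.
have hdual q q' : h q (p q').1 (+) h q (p q').2 = (q == q').
  rewrite /h; have [->|qq'] := eqVneq q q'; last by rewrite pA // addbb.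
  by rewrite g1 g2 eqxx eq_sym (negPf (pN _)).
exists (p r).1, (p r).2; split => //; last by split=> // q; apply: pA.
apply/setP => z; rewrite !inE; apply/imsetP/orP => [[x xt ->]|]; last first.
  by case=> /eqP->; [exists (p r).2 | exists (p r).1].
(* For a third node [z'], being matched to [r] in [t :\ x] and equal to [z'] is a predicate of [x]
   constant along every edge, hence on [t]; yet it fails at the ends of the [r]-edge. *)
apply/orP; apply: contraT; set z' := g _ _; rewrite negb_or => /andP[z1 z2].
have fc q : (g (t :\ (p q).1) r == z') = (g (t :\ (p q).2) r == z').
  have [->|qr] := eqVneq q r; last by rewrite pA // eq_sym.
  by rewrite g1 g2 ![_ == z']eq_sym (negPf z1) (negPf z2).
have := dual_cuts_constant (f := fun x => g (t :\ x) r == z') ct p1 p2 hdual fc.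
by move=> /(_ _ _ xt (p1 r)) /esym; rewrite eqxx g1 eq_sym (negPf z2).
Qed.

Lemma ends_spec (T R : finType) (g : {set T} -> R -> T) (r : R) (t : {set T}) x y :
  node_field g -> node_linkage g -> #|t| = #|R|.+1 ->
  x \in ends g r t -> y \in ends g r t -> x != y ->
  [/\ x \in t, y \in t, g (t :\ x) r = y, ends g r t = [set x; y] &
      forall q, q != r -> g (t :\ x) q = g (t :\ y) q].
Proof.
move=> gF gL ct; have [a [b [at_ bt nab -> [ga gb agree]]]] := ends_pair r gF gL ct.
case/set2P=> -> /set2P[]->; rewrite ?eqxx // => _; split => //.
  by rewrite setUC.
by move=> q /agree.
Qed.

Lemma card_ends (T R : finType) (g : {set T} -> R -> T) (r : R) (t : {set T}) :
  node_field g -> node_linkage g -> #|t| = #|R|.+1 -> #|ends g r t| = 2.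
Proof.
move=> gF gL ct; have [a [b [_ _ nab -> _]]] := ends_pair r gF gL ct.
by rewrite cards2 nab.
Qed.

(** * The [r]-edges inside a subset with [#|R|.+2] nodes *)

(** If [a], [b] are the ends in [t :\ x], then [b] is an end in [t :\ a], together with some [c].
    The symmetry [sym] closes the triangle: removing any of [a], [b], [c] leaves the other two as
    ends. *)
Lemma ends_triangle (T R : finType) (g : {set T} -> R -> T) (r : R) (t : {set T}) :
  node_field g -> node_linkage g -> #|t| = #|R|.+2 ->
  exists P : {set T}, [/\ P \subset t, #|P| = 3 &
    forall x, x \in t -> ends g r (t :\ x) \subset P].
Proof.
move=> gF gL ct.
have ctx x : x \in t -> #|t :\ x| = #|R|.+1 by apply: cardsD1_pred.
have sym x y z : x \in t -> y \in ends g r (t :\ x) -> z \in ends g r (t :\ x) ->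
    y != z -> z \in ends g r (t :\ y).
  move=> xt ye ze nyz.
  have [] := ends_spec gF gL (ctx x xt) ye ze nyz.
  rewrite !inE => /andP[nyx yt] /andP[nzx zt] <- _ _.
  by apply/imsetP; exists x; rewrite ?inE 1?eq_sym ?nyx // setDDl setUC -setDDl.
have other x y : x \in t -> y \in ends g r (t :\ x) ->
    exists2 z, z \in ends g r (t :\ x) & z != y.
  move=> xt ye; have : 0 < #|ends g r (t :\ x) :\ y|.
    by rewrite (cardsD1_pred (card_ends r gF gL (ctx x xt)) ye).
  by case/card_gt0P => z /setD1P[nzy ze]; exists z.
have inT x y : x \in t -> y \in ends g r (t :\ x) -> y \in t /\ y != x.
  move=> xt ye; have [z ze nzy] := other x y xt ye.
  have [_ ] := ends_spec gF gL (ctx x xt) ze ye nzy.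
  by rewrite !inE => /andP[].
have endsE x y z : x \in t -> y \in ends g r (t :\ x) -> z \in ends g r (t :\ x) ->
    y != z -> ends g r (t :\ x) = [set y; z].
  by move=> xt ye ze nyz; have [] := ends_spec gF gL (ctx x xt) ye ze nyz.
have /card_gt0P[x xt] : 0 < #|t| by rewrite ct.
have /card_gt0P[a ax] : 0 < #|ends g r (t :\ x)|.
  by rewrite (card_ends r gF gL (ctx x xt)).
have [b bx nba] := other x a xt ax.
have [[at_ nax] [bt nbx]] := (inT x a xt ax, inT x b xt bx).
have nab : a != b by rewrite eq_sym.
have ba := sym x a b xt ax bx nab; have ab := sym x b a xt bx ax nba.
have [c ca ncb] := other a b at_ ba; have [ct_ nca] := inT a c at_ ca.
have nbc : b != c by rewrite eq_sym.
have cb := sym a b c at_ ba ca nbc; have bc := sym a c b at_ ca ba ncb.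
have nac : a != c by rewrite eq_sym.
have ac := sym b c a bt cb ab nca.
set P := [set a; b; c].
have [aP bP cP] : [/\ a \in P, b \in P & c \in P].
  by rewrite /P !inE !eqxx !orbT.
have eP w x1 x2 : w \in t -> x1 \in ends g r (t :\ w) ->
    x2 \in ends g r (t :\ w) -> x1 != x2 -> x1 \in P -> x2 \in P ->
    ends g r (t :\ w) \subset P.
  by move=> wt e1 e2 n12 p1 p2; rewrite (endsE _ _ _ wt e1 e2 n12) subUset !sub1set p1.
have eaP := eP _ _ _ at_ ba ca nbc bP cP.
have ebP := eP _ _ _ bt ab cb nac aP cP.
have ecP := eP _ _ _ ct_ ac bc nab aP bP.
exists P; split=> [||y yt].
- by rewrite !subUset !sub1set at_ bt.
- by rewrite /P setUC cardsU1 cards2 !inE negb_or nca ncb nab.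
have [|] := boolP (y \in P).
  by rewrite !inE -orbA => /or3P[]/eqP->.
rewrite !inE !negb_or -andbA => /and3P[nya nyb nyc].
apply/subsetP => z ze; apply: contraT => zP.
have [z' z'e nz'z] := other y z yt ze.
(* The node matched to [r] in [t :\ y :\ w] is an end for both [t :\ y] and [t :\ w]. With [z]
   outside [P] it must be [z'], which thus differs from [w]; taking [w] to be [a], [b], [c] in turn
   excludes [z'] from [P]. *)
have valP w : w \in t -> y != w -> ends g r (t :\ w) \subset P ->
    z' \in P /\ z' != w.
  move=> wt nyw /subsetP esub.
  have vy : g (t :\ y :\ w) r \in ends g r (t :\ y).
    by apply/imsetP; exists w; rewrite ?inE 1?eq_sym ?nyw.
  have vw : g (t :\ y :\ w) r \in ends g r (t :\ w).
    by rewrite setDDl setUC -setDDl; apply/imsetP; exists y; rewrite ?inE ?nyw.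
  have [_ ] := inT w _ wt vw; have := esub _ vw.
  move: vy; rewrite (endsE _ _ _ yt ze z'e); last by rewrite eq_sym.
  by case/set2P=> ->; [rewrite (negPf zP) | split].
have [z'P nz'a] := valP a at_ nya eaP.
have [[_ nz'b] [_ nz'c]] := (valP b bt nyb ebP, valP c ct_ nyc ecP).
by move: z'P; rewrite !inE (negPf nz'a) (negPf nz'b) (negPf nz'c).
Qed.

(** * Doubling a right node *)

Lemma set2_sorted_inj n (x y a b : 'I_n) :
  [set x; y] = [set a; b] -> x < y -> a < b -> x = a /\ y = b.
Proof.
move=> eqS xy ab.
have /set2P hx : x \in [set a; b] by rewrite -eqS !inE eqxx.
have /set2P hy : y \in [set a; b] by rewrite -eqS !inE eqxx orbT.
by case: hx hy xy ab => -> [->|->] //; lia.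
Qed.

Lemma cards3_sorted n (P : {set 'I_n}) :
  #|P| = 3 -> exists a b c : 'I_n, [/\ a < b, b < c & P = [set a; b; c]].
Proof.
move=> cP.
have: sorted ltn (map val (enum P)).
  rewrite {1}/enum_mem -enumT; apply: (subseq_sorted ltn_trans (s2 := iota 0 n)).
    by rewrite -val_enum_ord; apply/map_subseq/filter_subseq.
  exact: iota_ltn_sorted.
have: size (enum P) = 3 by rewrite -cardE.
have memP x : (x \in P) = (x \in enum P) by rewrite mem_enum.
case: (enum P) memP => [|a [|b [|c []]]] //= memP _ /and3P[ab bc _].
by exists a, b, c; split=> //; apply/setP=> x; rewrite memP !inE orbA.
Qed.

(* The two copies of [r] are [Some r] and [None]; giving them the ends of the
   [r]-edge in increasing order is what makes the new field linkage at both. *)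
Definition doubles n (R : finType) (g : {set 'I_n} -> R -> 'I_n) (r : R)
    (g' : {set 'I_n} -> option R -> 'I_n) : Prop :=
  forall t : {set 'I_n}, #|t| = #|R|.+1 -> exists x y,
  [/\ ends g r t = [set x; y], x < y, g' t (Some r) = x, g' t None = y &
      forall q a, q != r -> a \in ends g r t -> g' t (Some q) = g (t :\ a) q].

Lemma doubles_exists n (R : finType) (g : {set 'I_n} -> R -> 'I_n) (r : R) :
  node_field g -> node_linkage g -> exists g', doubles g r g'.
Proof.
move=> gF gL.
suffices /fin_all_exists[g' gD] (t : {set 'I_n}) :
    exists h : option R -> 'I_n, #|t| = #|R|.+1 ->
    exists x y, [/\ ends g r t = [set x; y], x < y, h (Some r) = x, h None = y &
      forall q a, q != r -> a \in ends g r t -> h (Some q) = g (t :\ a) q].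
  by exists g'.
(* On subsets of another size any function will do; [g t r] merely supplies a node. *)
have [ct|nct] := eqVneq #|t| #|R|.+1;
  last by exists (fun=> g t r) => /eqP; rewrite (negPf nct).
have [x [y [_ _ nxy eE [_ _ agree]]]] := ends_pair r gF gL ct.
wlog xy : x y nxy eE agree / x < y => [wl|].
  have [|yx|eqxy] := ltngtP x y; first exact: wl.
    apply: (wl y x) => //; first by rewrite eq_sym.
      by rewrite setUC.
    by move=> q /agree.
  by move: nxy; rewrite (val_inj eqxy) eqxx.
exists (fun o => if o is Some q then if q == r then x else g (t :\ x) q else y).
move=> _; exists x, y; rewrite eqxx; split => // q a qr; rewrite (negPf qr).
by rewrite eE => /set2P[]-> //; apply: agree.
Qed.

(** The labels [q != r] keep their nodes whichever end of the [r]-edge is removed, so they avoid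
    both ends, which are free for the two copies of [r]. *)
Lemma doubles_field n (R : finType) (g : {set 'I_n} -> R -> 'I_n) (r : R) g' :
  node_field g -> node_linkage g -> doubles g r g' -> node_field g'.
Proof.
move=> gF gL gD t; rewrite card_option => ct.
have [x [y [eE xy g'r g'N g'q]]] := gD t ct.
have nxy : x != y by rewrite -val_eqE /= ltn_eqF.
have [ex ey] : x \in ends g r t /\ y \in ends g r t by rewrite eE !inE !eqxx orbT.
have [xt yt gx _ agree] := ends_spec gF gL ct ex ey nxy.
have [ginj gin] := gF _ (cardsD1_pred ct xt).
have [_ giny] := gF _ (cardsD1_pred ct yt).
have qx q : q != r -> g' t (Some q) = g (t :\ x) q by move=> qr; apply: g'q.
have nx q : q != r -> g (t :\ x) q != x.
  by move=> qr; have := gin q; rewrite !inE => /andP[].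
have ny q : q != r -> g (t :\ x) q != y.
  by move=> qr; have := giny q; rewrite agree // !inE => /andP[].
split; last first.
  case=> [q|]; last by rewrite g'N.
  have [->|qr] := eqVneq q r; first by rewrite g'r.
  by rewrite qx //; have := gin q; rewrite !inE => /andP[].
case=> [q|] [q'|] //.
- have [->|qr] := eqVneq q r; have [->|q'r] := eqVneq q' r; rewrite ?g'r ?qx // => eqg.
  + by have := nx _ q'r; rewrite -eqg eqxx.
  + by have := nx _ qr; rewrite eqg eqxx.
  + by rewrite (ginj _ _ eqg).
- have [->|qr] := eqVneq q r; rewrite g'N ?g'r ?qx // => eqg.
    by rewrite eqg eqxx in nxy.
  by have := ny _ qr; rewrite eqg eqxx.
- have [->|qr] := eqVneq q' r; rewrite g'N ?g'r ?qx // => eqg.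
    by rewrite eqg eqxx in nxy.
  by have := ny _ qr; rewrite eqg eqxx.
Qed.

(** Let [a < b < c] form the triangle of [r]. Removing [a] or [b] leaves the same larger end [c],
    whence linkage at [Some r]; removing [b] or [c] leaves the same smaller end [a], whence linkage
    at [None]. For [s != r], two nodes are found whose removal leaves the same pair of ends. *)
Lemma doubles_linkage n (R : finType) (g : {set 'I_n} -> R -> 'I_n) (r : R) g' :
  node_field g -> node_linkage g -> doubles g r g' -> node_linkage g'.
Proof.
move=> gF gL gD o t; rewrite card_option => ct.
have [P [Pt cP eP]] := ends_triangle r gF gL ct.
have ctx x : x \in t -> #|t :\ x| = #|R|.+1 by apply: cardsD1_pred.
have eD x : x \in P -> ends g r (t :\ x) = P :\ x.
  move=> xP; have xt := subsetP Pt x xP.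
  apply/eqP; rewrite eqEcard (card_ends r gF gL (ctx x xt)) (cardsD1_pred cP xP) leqnn andbT.
  apply/subsetD1P; split; first exact: eP.
  have [a [b [a_in b_in _ -> _]]] := ends_pair r gF gL (ctx x xt).
  by apply/set2P=> -[] xE; [move: a_in | move: b_in]; rewrite -xE !inE eqxx.
have g'D x a q : x \in t -> a \in ends g r (t :\ x) -> q != r ->
    g' (t :\ x) (Some q) = g (t :\ x :\ a) q.
  by move=> xt ae qr; have [? [? [_ _ _ _ /(_ q a qr ae)]]] := gD _ (ctx x xt).
have swapD x a q : g (t :\ x :\ a) q = g (t :\ a :\ x) q.
  by rewrite setDDl setUC -setDDl.
have sortedP : exists a b c : 'I_n, [/\ a < b, b < c, [/\ a \in P, b \in P & c \in P] &
    [/\ P :\ a = [set b; c], P :\ b = [set a; c] & P :\ c = [set a; b]]].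
  have [a [b [c [ab bc PE]]]] := cards3_sorted cP; exists a, b, c.
  by rewrite PE; split=> //; split; rewrite ?inE ?eqxx ?orbT //;
    apply/setP => z; rewrite !inE -!val_eqE /=; lia.
have ends_swap q x y u : q \in P -> x \in P :\ q -> y \in P :\ q -> u != r ->
    g (t :\ q :\ x) u = g (t :\ q :\ y) u.
  move=> qP xPq yPq ur; have [-> //|nxy] := eqVneq x y.
  have qt := subsetP Pt q qP; rewrite -!eD // in xPq yPq.
  by have [_ _ _ _ ->] := ends_spec gF gL (ctx q qt) xPq yPq nxy.
case: o => [s|]; first have [-> {s}|sr] := eqVneq s r.
- have [a [b [c [ab bc [aP bP cP'] [eA eB eC]]]]] := sortedP.
  have [at_ bt] := (subsetP Pt a aP, subsetP Pt b bP).
  exists a, b; split=> //; first by rewrite -val_eqE /= ltn_eqF.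
  have [xa [ya [Ea ltA _ g'Na _]]] := gD _ (ctx a at_).
  have [xb [yb [Eb ltB _ g'Nb _]]] := gD _ (ctx b bt).
  have [_ ya_c] : xa = b /\ ya = c by apply: set2_sorted_inj => //; rewrite -Ea eD.
  have [_ yb_c] : xb = a /\ yb = c.
    by apply: set2_sorted_inj (ltn_trans ab bc) => //; rewrite -Eb eD.
  case=> [q|] qr; last by rewrite g'Na g'Nb ya_c yb_c.
  have {}qr : q != r by apply: contraNneq qr => ->.
  by rewrite (g'D a b) ?(g'D b a) ?eD ?eA ?eB ?inE ?eqxx ?orbT //; apply: swapD.
- have [a [b [_ [ab _ [aP bP _] _]]]] := sortedP.
  have nab : a != b by rewrite -val_eqE /= ltn_eqF.
  pose y := g (t :\ a :\ b) s.
  (* Pairs in [P] are exchanged one node at a time: once a node of [P] is removed, the other two are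
     the ends of the [r]-edge, and swapping them does not affect [s]. *)
  have yE q q' : q \in P -> q' \in P -> q' != q -> g (t :\ q :\ q') s = y.
    move=> qP q'P nq'q; have [eqa|nqa] := eqVneq q a.
      by rewrite eqa in nq'q *; apply: ends_swap; rewrite ?inE ?nq'q ?bP // eq_sym nab.
    have -> : g (t :\ q :\ q') s = g (t :\ a :\ q) s.
      by rewrite (swapD a q); apply: ends_swap; rewrite ?inE ?nq'q ?aP // eq_sym nqa.
    by apply: ends_swap; rewrite ?inE ?nqa ?qP // eq_sym nab.
  have otherP q : q \in P -> exists2 q', q' \in P & q' != q.
    move=> qP; have : 0 < #|P :\ q| by rewrite (cardsD1_pred cP qP).
    by case/card_gt0P=> q' /setD1P[]; exists q'.
  have gin2 x x' q : x \in t -> x' \in t -> x' != x -> g (t :\ x :\ x') q \in t :\ x :\ x'.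
    move=> xt x't nx'x; have xx' : x' \in t :\ x by rewrite !inE nx'x.
    by have [_] := gF _ (cardsD1_pred (ctx x xt) xx').
  have yt : y \in t.
    have := gin2 a b s (subsetP Pt a aP) (subsetP Pt b bP).
    by rewrite eq_sym nab !inE => /(_ isT) /and3P[].
  have nyP q : q \in P -> y != q.
    move=> qP; have [q' q'P nq'q] := otherP q qP.
    have := gin2 q q' s (subsetP Pt q qP) (subsetP Pt q' q'P) nq'q.
    by rewrite yE // !inE => /and3P[].
  have [q1 [q2 [q1y q2y nq12 ey [_ _ agree]]]] := ends_pair r gF gL (ctx y yt).
  pose p := g (t :\ y :\ q1) s.
  have pE q : q \in ends g r (t :\ y) -> g (t :\ q :\ y) s = p.
    by rewrite ey swapD => /set2P[]-> //; rewrite -agree.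
  have [pt npy] : p \in t /\ p != y.
    move: q1y; rewrite !inE => /andP[nq1y q1t].
    by have := gin2 y q1 s yt q1t nq1y; rewrite !inE => /and3P[].
  (* Two 2-subsets of [P] meet. For a common end [q], the [s]-edge on [t :\ q] joins [y] and [p], so
     removing [y] or [p] from [t :\ q] only affects [s]. *)
  have /card_gt0P[q] : 0 < #|ends g r (t :\ y) :&: ends g r (t :\ p)|.
    have : #|ends g r (t :\ y) :|: ends g r (t :\ p)| <= 3.
      by rewrite -cP subset_leq_card // subUset !eP.
    have := cardsUI (ends g r (t :\ y)) (ends g r (t :\ p)).
    by rewrite !(card_ends r gF gL (ctx _ _)) //; lia.
  rewrite inE => /andP[qy qp].
  have qP := subsetP (eP y yt) q qy; have qt := subsetP Pt q qP.
  have [q' q'P nq'q] := otherP q qP.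
  have yes : y \in ends g s (t :\ q).
    by apply/imsetP; exists q'; rewrite ?yE // !inE nq'q (subsetP Pt).
  have pes : p \in ends g s (t :\ q).
    by apply/imsetP; exists y; rewrite ?pE // !inE nyP.
  have nyp : y != p by rewrite eq_sym.
  have [_ _ _ _ gyp] := ends_spec gF gL (ctx q qt) yes pes nyp.
  have endsE x : x \in t -> q \in ends g r (t :\ x) ->
      ends g r (t :\ x) = [set q; g (t :\ q :\ x) r].
    move=> xt qx; have : 0 < #|ends g r (t :\ x) :\ q|.
      by rewrite (cardsD1_pred (card_ends r gF gL (ctx x xt)) qx).
    case/card_gt0P=> z /setD1P[nzq zx]; have nqz : q != z by rewrite eq_sym.
    by rewrite swapD; have [_ _ -> ->] := ends_spec gF gL (ctx x xt) qx zx nqz.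
  exists y, p; split=> // o os.
  have [x1 [y1 [E1 lt1 g'r1 g'N1 g'q1]]] := gD _ (ctx y yt).
  have [x2 [y2 [E2 lt2 g'r2 g'N2 g'q2]]] := gD _ (ctx p pt).
  (* Agreement at [r] gives [t :\ y] and [t :\ p] the same second end besides [q], hence the same
     ordered pair. *)
  have [eqx eqy] : x1 = x2 /\ y1 = y2.
    have rs : r != s by rewrite eq_sym.
    apply: set2_sorted_inj lt1 lt2.
    by rewrite -E1 -E2 (endsE y yt qy) (endsE p pt qp) (gyp r rs).
  rewrite eqx eqy in g'r1 g'N1.
  case: o os => [u|] os; last by rewrite g'N1 g'N2.
  have [->|ur] := eqVneq u r; first by rewrite g'r1 g'r2.
  have us : u != s by apply: contraNneq os => ->.
  by rewrite (g'q1 u q ur qy) (g'q2 u q ur qp) (swapD y) (swapD p); apply: gyp.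
- have [a [b [c [ab bc [aP bP cP'] [eA eB eC]]]]] := sortedP.
  have [bt ct'] := (subsetP Pt b bP, subsetP Pt c cP').
  exists b, c; split=> //; first by rewrite -val_eqE /= ltn_eqF.
  have [xb [yb [Eb ltB g'rb _ _]]] := gD _ (ctx b bt).
  have [xc [yc [Ec ltC g'rc _ _]]] := gD _ (ctx c ct').
  have [xb_a _] : xb = a /\ yb = c.
    by apply: set2_sorted_inj (ltn_trans ab bc) => //; rewrite -Eb eD.
  have [xc_a _] : xc = a /\ yc = b by apply: set2_sorted_inj => //; rewrite -Ec eD.
  case=> [q|] // _; have [->|qr] := eqVneq q r; first by rewrite g'rb g'rc xb_a xc_a.
  rewrite (g'D b a) ?(g'D c a) ?eD ?eC ?eB ?inE ?eqxx ?orbT //.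
  rewrite !(swapD _ a); apply: ends_swap => //; by rewrite eA !inE eqxx ?orbT.
Qed.

(** * Surjectivity onto the lattice points *)

(* The cardinal is the degree of [q] in the Chow covector of [~: s]. *)
Lemma chow_degrees_onto n k (R : finType) (g : {set 'I_n} -> R -> 'I_n) (w : R -> nat) :
  node_field g -> node_linkage g -> n = #|R| + k -> \sum_r w r = k.+1 ->
  exists s : {set 'I_n}, #|s|.+1 = #|R| /\
    forall q, #|[set j in ~: s | g (j |: s) q == j]| = w q.
Proof.
elim: k R g w => [|k IH] R g w gF gL nE sw.
  rewrite addn0 in nE.
  have cT : #|[set: 'I_n]| = #|R| by rewrite cardsT card_ord.
  have [ginj gin] := gF _ cT.
  (* Here [w] is the unit vector at [i], realised by leaving out the node that the only matching
     assigns to [i]. *)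
  have [i wi w0] : exists2 i, w i = 1 & forall q, q != i -> w q = 0.
    have /existsP[i wi] : [exists i, w i != 0].
      apply: contra_eqT sw; rewrite negb_exists => /forallP w0.
      by rewrite big1 // => i _; apply/eqP; have := w0 i; rewrite negbK.
    move: sw; rewrite (bigD1 i) //= => sw.
    have /eqP : \sum_(q | q != i) w q = 0 by lia.
    rewrite sum_nat_eq0 => /forall_inP w0.
    by exists i; [lia | move=> q /w0/eqP].
  have cx : #|~: [set g setT i]|.+1 = #|R|.
    by have := cardsC [set g setT i]; rewrite cards1 card_ord; lia.
  exists (~: [set g setT i]); split=> // q; rewrite setCK.
  have [->|qi] := eqVneq q i.
    rewrite wi -(cards1 (g setT i)); apply: eq_card => j; rewrite !inE.
    by case: eqVneq => // ->; rewrite setUCr eqxx.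
  rewrite w0 //; apply: eq_card0 => j; rewrite !inE; case: eqVneq => // ->.
  by rewrite setUCr (inj_eq ginj) (negPf qi).
have [r wr] : exists r, 0 < w r.
  apply/existsP; apply: contra_eqT sw; rewrite negb_exists => /forallP w0.
  by rewrite big1 // => i _; apply/eqP; have := w0 i; rewrite -eqn0Ngt.
have [g' gD] := doubles_exists r gF gL.
have g'F := doubles_field gF gL gD; have g'L := doubles_linkage gF gL gD.
(* The copy [None] gets degree 0 and [Some r] one less than [w r]; the node [a] below restores the
   missing edge at [r]. *)
pose w' o := if o is Some q then w q - (q == r) else 0.
have sumw' : \sum_o w' o = k.+1.
  rewrite (bigD1 None) //= add0n (reindex_omap Some id) => [|[]//].
  rewrite (eq_bigl xpredT) => [|q]; last by rewrite /= eqxx.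
  rewrite (bigD1 r) //= eqxx.
  move: sw; rewrite (bigD1 r) //= => sw.
  rewrite (eq_bigr w); first by lia.
  by move=> q /negPf->; rewrite subn0.
have nE' : n = #|{: option R}| + k by rewrite card_option; lia.
have [s' [cs' degs']] := IH _ g' w' g'F g'L nE' sumw'.
rewrite card_option in cs'; case: cs' => cs'.
have [g's'inj g's'in] := gF _ cs'.
pose a := g s' r; have as' : a \in s' by apply: g's'in.
exists (s' :\ a); split; first by rewrite -cs' [in RHS](cardsD1 a) as'.
(* The ends of the [r]-edge on [j |: s'] are [a] and some [z]. Since [None] has degree 0, [j] is not
   the larger end, so [z = j] exactly when [j] goes to [Some r]. *)
have key j q : j \notin s' ->
    (g (j |: s' :\ a) q == j) = (g' (j |: s') (Some q) == j).
  move=> js'; set t := j |: s'.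
  have ct : #|t| = #|R|.+1 by rewrite cardsU1 js' cs'.
  have jt : j \in t by rewrite !inE eqxx.
  have nja : j != a by apply: contraNneq js' => ->.
  have taE : j |: s' :\ a = t :\ a.
    by apply/setP => i; rewrite !inE; case: (eqVneq i j) => [->|]; rewrite ?nja ?orbF.
  have tjE : t :\ j = s' by rewrite setU1K.
  have ae : a \in ends g r t by apply/imsetP; exists j; rewrite ?tjE.
  have at_ : a \in t by rewrite !inE as' orbT.
  have nNj : g' t None != j.
    apply: contraTneq isT => gNj; suff: w' None != 0 by [].
    by rewrite -degs' -lt0n; apply/card_gt0P; exists j; rewrite !inE js' -/t gNj eqxx.
  have [x [y [eE xy g'r g'N g'q]]] := gD t ct.
  have [z ze nza] : exists2 z, z \in ends g r t & a != z.
    have : 0 < #|ends g r t :\ a| by rewrite (cardsD1_pred (card_ends r gF gL ct) ae).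
    by case/card_gt0P=> z /setD1P[nza ze]; exists z; rewrite // eq_sym.
  have [_ _ gaz eE' _] := ends_spec gF gL ct ae ze nza.
  have [gainj gain] := gF _ (cardsD1_pred ct at_).
  rewrite taE; have [->|qr] := eqVneq q r; last by rewrite (g'q q a qr ae).
  rewrite gaz g'r; move: nNj; rewrite g'N => nyj.
  have [zj|nzj] := eqVneq z j.
    have : j \in ends g r t by rewrite -zj.
    by rewrite eE !inE eq_sym [j == y]eq_sym (negPf nyj) orbF => ->.
  have : x \in ends g r t by rewrite eE !inE eqxx.
  rewrite eE' => /set2P[] ->; last by rewrite (negPf nzj).
  by rewrite eq_sym (negPf nja).
(* Adding [a] to [s' :\ a] gives back [s'], where [a] is matched to [r]: it contributes one edge, at
   [r]. *)
move=> q; rewrite (cardsD1 a) !inE eqxx /= setD1K // (inj_eq g's'inj).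
suff -> : [set j in ~: (s' :\ a) | g (j |: s' :\ a) q == j] :\ a =
    [set j in ~: s' | g' (j |: s') (Some q) == j].
  rewrite degs' /=; case: eqVneq => [->|_]; [by lia | by rewrite subn0].
apply/setP => j; rewrite !inE; case: (eqVneq j a) => [->|nja] /=; first by rewrite as'.
by case: (boolP (j \in s')) => //= js'; apply: key.
Qed.

(** * From edge sets to node functions *)

Lemma matching_field_nodes n d (M : {set 'I_n} -> {set 'I_n * 'I_d}) :
  d <= n -> matching_field M -> exists2 g : {set 'I_n} -> 'I_d -> 'I_n,
    node_field g & forall s : {set 'I_n}, #|s| = d ->
      forall l r, ((l, r) \in M s) = (g s r == l).
Proof.
move=> le_dn Mf.
have /fin_all_exists[g gP] (s : {set 'I_n}) : exists h : 'I_d -> 'I_n, #|s| = d ->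
    forall l r, ((l, r) \in M s) = (h r == l).
  (* The embedding given by [d <= n] is a default value for subsets of the wrong size. *)
  have [cs|ncs] := eqVneq #|s| d;
    last by exists (widen_ord le_dn) => /eqP; rewrite (negPf ncs).
  have [_ _ deg1] := Mf s cs.
  have /fin_all_exists[h hP] r : exists l, [set e in M s | e.2 == r] = [set (l, r)].
    have /eqP/cards1P[[l q] eE] := deg1 r; exists l; rewrite eE.
    have : (l, q) \in [set e in M s | e.2 == r] by rewrite eE !inE.
    by rewrite !inE => /andP[_ /= /eqP->].
  exists h => _ l r; have /setP/(_ (l, r)) := hP r.
  by rewrite !inE /= eqxx andbT xpair_eqE eqxx andbT eq_sym.
exists g => // s; rewrite card_ord => cs; have [sub deg1 _] := Mf s cs.
have gM r : (g s r, r) \in M s by rewrite gP.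
split=> [r r' eqg|r]; last exact: (sub _ (gM r)).
have /eqP/cards1P[e eE] := deg1 _ (sub _ (gM r)).
have : (g s r, r) \in [set e] by rewrite -eE inE gM eqxx.
have : (g s r', r') \in [set e] by rewrite -eE inE gM /= eqg eqxx.
by move=> /set1P<- /set1P[].
Qed.

Lemma linkage_nodes n d (M : {set 'I_n} -> {set 'I_n * 'I_d}) g :
  (forall s : {set 'I_n}, #|s| = d -> forall l r, ((l, r) \in M s) = (g s r == l)) ->
  linkage M -> node_linkage g.
Proof.
move=> gP ML r t; rewrite card_ord => ct; have [x [y [xt yt nxy eqM]]] := ML r t ct.
exists x, y; split=> // q qr; apply/esym/eqP.
rewrite -gP ?(cardsD1_pred ct yt) //.
have /setP/(_ (g (t :\ x) q, q)) := eqM.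
by rewrite !inE /= qr !andbT gP ?(cardsD1_pred ct xt) // eqxx => <-.
Qed.

Lemma chow_degree n d (M : {set 'I_n} -> {set 'I_n * 'I_d}) g (rho : {set 'I_n}) :
  (forall s : {set 'I_n}, #|s| = d -> forall l r, ((l, r) \in M s) = (g s r == l)) ->
  #|~: rho|.+1 = d -> forall q,
  right_degree (chow_covector M rho) q = #|[set j in rho | g (j |: ~: rho) q == j]|.
Proof.
move=> gP cr q; rewrite ffunE.
have pair_inj : injective (fun j : 'I_n => (j, q)) by move=> i j [].
have in_chow j : ((j, q) \in chow_covector M rho) = (j \in rho) && (g (j |: ~: rho) q == j).
  rewrite inE /=; case: (boolP (j \in rho)) => //= jr.
  by rewrite setUC gP // cardsU1 inE jr.
rewrite -(card_imset _ pair_inj); apply: eq_card => -[j r].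
apply/idP/imsetP => [|[i ir [-> ->]]].
  by case/setIdP=> jrM /eqP rq; move: jrM; rewrite [r]rq in_chow => jr; exists j; rewrite ?inE.
by apply/setIdP; rewrite in_chow; split=> //; rewrite inE in ir.
Qed.

(** * Bijectivity by counting *)

Theorem theorem3p23 (n d : nat) (M : {set 'I_n} -> {set 'I_n * 'I_d}) :
  0 < d -> d <= n ->
  matching_field M -> linkage M ->
  (* well-defined: lands in the lattice points of (n-d+1) Delta_{d-1} *)
  [/\ (forall rho : {set 'I_n}, #|rho| = n - d + 1 ->
         \sum_(r < d) right_degree (chow_covector M rho) r = n - d + 1),
      (* injective *)
      (forall rho1 rho2 : {set 'I_n}, #|rho1| = n - d + 1 -> #|rho2| = n - d + 1 ->
         right_degree (chow_covector M rho1) = right_degree (chow_covector M rho2) ->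
         rho1 = rho2)
    & (* surjective *)
      (forall v : {ffun 'I_d -> nat}, \sum_(r < d) v r = n - d + 1 ->
         exists rho : {set 'I_n}, #|rho| = n - d + 1 /\
           right_degree (chow_covector M rho) = v)].
Proof.
move=> d_gt0 le_dn Mf ML.
have [g gF gP] := matching_field_nodes le_dn Mf.
have gL := linkage_nodes gP ML.
set K := n - d + 1.
have cC (rho : {set 'I_n}) : #|rho| = K -> #|~: rho|.+1 = d.
  by move=> cr; have := cardsC rho; rewrite card_ord; lia.
have deg_sum (rho : {set 'I_n}) : #|rho| = K ->
    \sum_(r < d) right_degree (chow_covector M rho) r = K.
  move=> cr; under eq_bigr => r _ do rewrite (chow_degree gP (cC _ cr)) -sum1dep_card.
  under eq_bigr => r _ do rewrite big_mkcondr /=.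
  (* After the exchange, each [j] in [rho] counts the right nodes matched to it in [j |: ~: rho], of
     which there is exactly one. *)
  rewrite exchange_big /= -[RHS]cr -sum1_card; apply: eq_bigr => j jr.
  have cs : #|j |: ~: rho| = #|'I_d| by rewrite cardsU1 inE jr card_ord -(cC _ cr).
  have [r gr] : exists r, g (j |: ~: rho) r = j.
    by apply: node_field_onto => //; rewrite !inE eqxx.
  have [ginj _] := gF _ cs.
  rewrite (bigD1 r) //= gr eqxx big1 // => q qr.
  by rewrite -[X in _ == X]gr (inj_eq ginj) (negPf qr).
have deg_onto (v : {ffun 'I_d -> nat}) : \sum_(r < d) v r = K ->
    exists rho : {set 'I_n}, #|rho| = K /\ right_degree (chow_covector M rho) = v.
  move=> sv.
  have [||s [cs sv']] := chow_degrees_onto (k := n - d) (w := v) gF gL.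
  - by rewrite card_ord subnKC.
  - by rewrite sv /K addn1.
  rewrite card_ord in cs; have := cardsC s; rewrite card_ord => cs'.
  exists (~: s); split; first by rewrite /K; lia.
  by apply/ffunP => q; rewrite (chow_degree gP) setCK.
split=> // rho1 rho2 c1 c2 eq_deg.
pose D := [set rho : {set 'I_n} | #|rho| == K].
pose deg (rho : {set 'I_n}) : d.-tuple 'I_K.+1 :=
  [tuple inord (right_degree (chow_covector M rho) i) | i < d].
(* There are ['C(n, K)] subsets in [D] and, by stars and bars, as many lattice points; the image
   contains them all, so [deg] is injective on [D]. *)
suff /imset_injP degI : #|deg @: D| == #|D|.
  by apply: degI; rewrite ?inE ?c1 ?c2 //; apply: eq_from_tnth => i; rewrite !tnth_mktuple eq_deg.
rewrite eqn_leq leq_imset_card card_draws card_ord /=.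
have -> : 'C(n, K) = #|[set t : d.-tuple 'I_K.+1 | \sum_(i <- t) i == K]|.
  rewrite /K; case: d d_gt0 le_dn {M Mf ML g gF gP gL K cC deg_sum deg_onto eq_deg c1 c2 D deg} => // m _ le_mn.
  have -> : n - m.+1 + 1 = n - m by lia.
  by rewrite card_ord_partitions subnKC 1?ltnW // bin_sub // ltnW.
apply/subset_leq_card/subsetP => t; rewrite inE big_tuple => /eqP st.
have [|rho [cr degE]] := deg_onto [ffun i => val (tnth t i)].
  by rewrite -[RHS]st; apply: eq_bigr => i _; rewrite ffunE.
apply/imsetP; exists rho; first by rewrite inE cr.
by apply: eq_from_tnth => i; rewrite tnth_mktuple degE ffunE inord_val.
Qed.
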